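(* Let $I=[a,b]\subset\mathbb{R}$, let $\varphi:I\to I$, let $s\in(0,1)$, and let $f:I\to[0,\infty)$ be a $\varphi_s$-convex function. Let $t_1,\dots,t_n\in(0,1)$ with $\sum_{i=1}^n t_i=1$, and let $x_1,\dots,x_n\in I$. Then $$f\left(\sum_{i=1}^n t_i\varphi(x_i)\right)\le\sum_{i=1}^n t_i^s f(\varphi(x_i)).$$
   Context: A function $f:I\to[0,\infty)$ is $\varphi_s$-convex ($s\in(0,1)$) if $f(t\varphi(x)+(1-t)\varphi(y))\le t^s f(\varphi(x))+(1-t)^s f(\varphi(y))$ for all $x,y\in I$ and $t\in(0,1)$. *)

(* Defs.v *)
From mathcomp Require Import all_boot all_order all_algebra.
From mathcomp Require Import all_classical all_reals all_analysis.
Set Implicit Arguments.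
Unset Strict Implicit.
Unset Printing Implicit Defensive.
Import Order.TTheory GRing.Theory Num.Theory.
Local Open Scope ring_scope.

(* [phi] and [f] are total on [R] but are only ever evaluated on [I] as soon as
   [phi] maps the interval [I] to itself; that [phi : I -> I], that [f] is
   nonnegative on [I] and that [0 < s < 1] are hypotheses kept separate. *)
Definition phi_s_convex (R : realType) (I : interval R) (phi : R -> R) (s : R)
    (f : R -> R) : Prop :=
  forall x y t : R, x \in I -> y \in I -> 0 < t < 1 ->
    f (t * phi x + (1 - t) * phi y) <=
      t `^ s * f (phi x) + (1 - t) `^ s * f (phi y).

(* Main.v *)
(* The objective [\sum_i t_i^s f(phi x_i)] is concave in [t], so over the
   polytope of weights with a prescribed barycenter [\sum_i t_i phi(x_i)] it is
   smallest at a vertex. Since the points are real numbers, vertices have at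
   most two nonzero weights, where the bound is [phi_s]-convexity itself. This
   detour is needed because the partial barycenters of the usual induction on
   [n] may leave the image of [phi]. *)
Require Import Defs.
From mathcomp Require Import all_boot all_order all_algebra.
From mathcomp Require Import all_classical all_reals all_analysis.
From mathcomp Require Import ring.
Import Order.TTheory GRing.Theory Num.Theory.
Local Open Scope ring_scope.

(** Concavity of the power in tangent form. It is Young's inequality for [(y / x)]^
    s[and]1[with conjugate exponents]s^-1[and](1 - s)^-1[, scaled by]x [^ s]. *)
Lemma powR_le_tangent (R : realType) (s x y : R) :
  0 < s < 1 -> 0 < x -> 0 <= y ->
  y `^ s <= x `^ s + s * (x `^ s / x) * (y - x).
Proof.
move=> /andP[s0 s1] x0 y0.
have r0 : 0 <= y / x by rewrite divr_ge0// ltW.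
have yE : y = x * (y / x) by field; rewrite gt_eqF.
have Young : (y / x) `^ s <= s * (y / x) + (1 - s).
  have := @conjugate_powR R ((y / x) `^ s) 1 s^-1 (1 - s)^-1.
  rewrite !invrK mulr1 -powRrM mulfV ?gt_eqF// powRr1// powR1 mul1r.
  rewrite (mulrC s); apply=> //; first exact: powR_ge0.
  - by rewrite invr_gt0.
  - by rewrite invr_gt0 subr_gt0.
  - by rewrite addrCA subrr addr0.
rewrite {1}yE powRM ?(ltW x0)//.
have -> : x `^ s + s * (x `^ s / x) * (y - x) =
          x `^ s * (s * (y / x) + (1 - s)).
  by field; rewrite gt_eqF.
by rewrite ler_wpM2l// powR_ge0.
Qed.

(** Three unknowns face only two linear equations. Moving the weights [t] along [d] preserves their
    total and their barycenter, and weights that are already zero stay zero. *)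
Lemma exists_affine_relation (R : realType) (I : finType) (p t : I -> R) :
  (2 < #|[set i | t i != 0%R]|)%N ->
  exists d : I -> R, [/\ exists i, d i != 0, \sum_i d i = 0,
    \sum_i d i * p i = 0 & forall i, t i = 0 -> d i = 0].
Proof.
move=> /card_gt2P[i [j [k [[]]]]]; rewrite !inE => ti tj tk [ij jk ki].
pose d A B C (l : I) : R :=
  (if l == i then A else 0) + (if l == j then B else 0)
    + (if l == k then C else 0).
have sumd A B C (g : I -> R) :
    \sum_l d A B C l * g l = A * g i + B * g j + C * g k.
  under eq_bigr do rewrite !mulrDl.
  rewrite !big_split/=.
  have pick m (D : R) : \sum_l (if l == m then D else 0) * g l = D * g m.
    rewrite (bigD1 m)//= eqxx big1 ?addr0// => l /negbTE->.
    by rewrite mul0r.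
  by rewrite !pick.
have sumd1 A B C : \sum_l d A B C l = A + B + C.
  have := sumd A B C (fun=> 1); rewrite !mulr1 => <-.
  by apply: eq_bigr => l _; rewrite mulr1.
have dsupp A B C l : t l = 0 -> d A B C l = 0.
  move=> tl0; rewrite /d; have neq m : t m != 0 -> (l == m) = false.
    by apply: contraNF => /eqP <-; apply/eqP.
  by rewrite !neq// !addr0.
(* The general solution is, up to sign, the cross product of [(1, 1, 1)] and [(p i, p j, p k)]. It
   vanishes when the three points coincide, so equal points are treated apart by shifting weight
   from [j] to [i]. *)
have [pij|pij] := eqVneq (p i) (p j).
- exists (d 1 (-1) 0); split; last exact: dsupp.
  + exists i; rewrite /d eqxx (negbTE ij) (eq_sym i k) (negbTE ki).
    by rewrite !addr0 oner_eq0.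
  + by rewrite sumd1; ring.
  + by rewrite sumd pij; ring.
- exists (d (p j - p k) (p k - p i) (p i - p j)); split; last exact: dsupp.
  + exists k; rewrite /d eqxx (negbTE ki) (eq_sym k j) (negbTE jk) !add0r.
    by rewrite subr_eq0.
  + by rewrite sumd1; ring.
  + by rewrite sumd; ring.
Qed.

Lemma sum0_exists_lt0 (R : realType) (I : finType) (d : I -> R) :
  \sum_i d i = 0 -> (exists i, d i != 0) -> exists i, d i < 0.
Proof.
move=> sum0 [i di]; apply/existsP; apply: contraNT di => /existsPn dge0.
apply/eqP/(psumr_eq0P _ sum0) => // j _.
by rewrite leNgt dge0.
Qed.

(** Move from [t] along [d] until the first weight reaches zero: [e] is the least ratio
    [t i / - d i] over the indices with [d i < 0]. *)
Lemma shrink_support (R : realType) (I : finType) (t d : I -> R) :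
  (forall i, 0 <= t i) -> (forall i, t i = 0 -> d i = 0) ->
  (exists i, d i < 0) ->
  exists e : R, [/\ 0 <= e, forall i, 0 <= t i + e * d i &
    (#|[set i | (t i + e * d i != 0)%R]| < #|[set i | t i != 0%R]|)%N].
Proof.
move=> t0 dsupp [i0 di0].
have [i di imin] := @Order.TotalTheory.arg_minP _ _ _ i0
  (fun i => d i < 0) (fun i => t i / - d i) di0.
have e0 : 0 <= t i / - d i by rewrite divr_ge0// oppr_ge0 ltW.
have ei : t i + t i / - d i * d i = 0 by field; rewrite lt_eqF.
exists (t i / - d i); split=> //.
- move=> j; have [dj|dj] := ltP (d j) 0; last by rewrite addr_ge0// mulr_ge0.
  have := imin j dj; rewrite ler_pdivlMr ?oppr_gt0// mulrN.
  by rewrite -subr_ge0 opprK.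
- apply: proper_card; apply/properP; split.
    apply/fintype.subsetP => j; rewrite !inE; apply: contra_neq => tj.
    by rewrite tj (dsupp j)// mulr0 addr0.
  exists i; rewrite !inE; last by rewrite ei eqxx.
  by apply: contraTneq di => /dsupp ->; rewrite ltxx.
Qed.

(** Weights may vanish here, so the induction on the size of the support keeps the index type
    fixed. *)
Lemma s_jensen (R : realType) (I : finType) (s : R) (f : R -> R)
    (p t : I -> R) :
  0 < s < 1 -> (forall i, 0 <= f (p i)) ->
  (forall i j u, 0 < u < 1 ->
     f (u * p i + (1 - u) * p j) <=
       u `^ s * f (p i) + (1 - u) `^ s * f (p j)) ->
  (forall i, 0 <= t i) -> \sum_i t i = 1 ->
  f (\sum_i t i * p i) <= \sum_i t i `^ s * f (p i).
Proof.
move=> s01 f0 fconv; have [m] := ubnP #|[set i | t i != 0]|.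
have sn0 : s != 0 by case/andP: s01 => /gt_eqF ->.
elim: m t => // m IH t ltm t0 sum1.
have sum_supp (g : I -> R) : (forall i, t i = 0 -> g i = 0) ->
    \sum_i g i = \sum_(i in [set i | t i != 0]) g i.
  move=> g0; rewrite [LHS](bigID (mem [set i | t i != 0]))/=.
  by rewrite [X in _ + X]big1 ?addr0// => i; rewrite inE negbK => /eqP/g0.
have [gt2|] := ltnP 2 #|[set i | t i != 0]|.
  (* On the support, [s * c i] is the partial derivative of the objective at [t]. Replacing [d] by
     its opposite if necessary, the objective does not increase along [d] to first order. *)
  pose c i := t i `^ s / t i * f (p i).
  have [d [[i di] sumd sumdp dsupp cd]] : exists d : I -> R,
      [/\ exists i, d i != 0, \sum_i d i = 0, \sum_i d i * p i = 0,
          forall i, t i = 0 -> d i = 0 & \sum_i c i * d i <= 0].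
    have [d [[i di] sumd sumdp dsupp]] := @exists_affine_relation R I p t gt2.
    have [cd|/ltW cd] := leP (\sum_i c i * d i) 0.
      by exists d; split => //; exists i.
    exists (fun i => - d i); split.
    - by exists i; rewrite oppr_eq0.
    - by rewrite sumrN sumd oppr0.
    - by under eq_bigr do rewrite mulNr; rewrite sumrN sumdp oppr0.
    - by move=> j /dsupp ->; rewrite oppr0.
    - by under eq_bigr do rewrite mulrN; rewrite sumrN oppr_le0.
  have dlt0 : exists i, d i < 0 by apply: sum0_exists_lt0 => //; exists i.
  have [e [e0 te0 lte]] := @shrink_support R I t d t0 dsupp dlt0.
  have := IH (fun i => t i + e * d i) (leq_trans lte ltm) te0.
  rewrite big_split/= -mulr_sumr sumd mulr0 addr0 => /(_ sum1).
  under eq_bigr do rewrite mulrDl -mulrA.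
  rewrite big_split/= -mulr_sumr sumdp mulr0 addr0 => /le_trans; apply.
  (* Splitting off the first-order term, which has the favourable sign, leaves a termwise
     comparison: the tangent bound where [t j] is positive, and an equality where it is zero. *)
  have -> : \sum_i t i `^ s * f (p i) =
      \sum_i (t i `^ s * f (p i) + s * e * (c i * d i))
        - s * e * \sum_i c i * d i.
    by rewrite big_split/= -mulr_sumr addrK.
  have se0 : 0 <= s * e by rewrite mulr_ge0// ltW//; case/andP: s01.
  rewrite ler_wpDr ?oppr_ge0 ?mulr_ge0_le0//.
  apply: ler_sum => j _; have [tj|tj] := eqVneq (t j) 0.
    by rewrite tj dsupp// !mulr0 !addr0.
  have tj0 : 0 < t j by rewrite lt_def tj t0.
  have := @powR_le_tangent R s (t j) _ s01 tj0 (te0 j).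
  move=> /(ler_wpM2r (f0 j)) /le_trans; apply.
  by rewrite le_eqVlt; apply/orP; left; apply/eqP; rewrite /c; ring.
have sum1' := sum1; rewrite sum_supp// in sum1'.
(* Two nonzero weights give the convexity hypothesis, a single one must equal [1], and an empty
   support contradicts the total [1]. *)
rewrite leq_eqVlt ltnS leq_eqVlt ltnS leqn0 => /or3P[/cards2P[i [j [ij E]]]|
  /cards1P[i E]|/eqP/cards0_eq E].
- have tpos k : k \in [set i | t i != 0] -> 0 < t k.
    by rewrite inE lt_def t0 andbT.
  have ti : 0 < t i by apply: tpos; rewrite E !inE eqxx.
  have tj : 0 < t j by apply: tpos; rewrite E !inE eqxx orbT.
  rewrite !sum_supp; last 2 first.
  + by move=> k ->; rewrite powR0// mul0r.
  + by move=> k ->; rewrite mul0r.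
  rewrite E !big_setU1 ?inE//= !big_set1 in sum1' *.
  have tjE : t j = 1 - t i by rewrite -sum1' addrAC subrr add0r.
  rewrite tjE; apply: fconv; rewrite ti//=.
  by rewrite -subr_gt0 -tjE tj.
- rewrite !sum_supp; last 2 first.
  + by move=> k ->; rewrite powR0// mul0r.
  + by move=> k ->; rewrite mul0r.
  rewrite E !big_set1 in sum1' *.
  by rewrite sum1' powR1 !mul1r.
- by move: sum1'; rewrite E big_set0 => /eqP; rewrite eq_sym oner_eq0.
Qed.

Theorem theorem2 (R : realType) (a b : R) (phi : R -> R) (s : R) (f : R -> R)
    (phiI : forall x : R, x \in `[a, b] -> phi x \in `[a, b])
    (s01 : 0 < s < 1)
    (f_ge0 : forall x : R, x \in `[a, b] -> 0 <= f x)
    (f_conv : phi_s_convex `[a, b] phi s f)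
    (n : nat) (t x : 'I_n -> R)
    (t01 : forall i : 'I_n, 0 < t i < 1)
    (sum_t : \sum_(i < n) t i = 1)
    (xI : forall i : 'I_n, x i \in `[a, b]) :
  f (\sum_(i < n) t i * phi (x i)) <=
    \sum_(i < n) (t i) `^ s * f (phi (x i)).
Proof.
apply: (@s_jensen R 'I_n s f (fun i => phi (x i)) t) => //.
- by move=> i; exact/f_ge0/phiI.
- by move=> i j u u01; exact: f_conv.
- by move=> i; case/andP: (t01 i) => /ltW.
Qed.
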